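(* Let $((\mathbf{u},p),(\boldsymbol{\phi},r),\mathbf{y})\in V\times V\times Q_{ad}$ solve the continuous optimality system and let $((\mathbf{u}_h,p_h),(\boldsymbol{\phi}_h,r_h),\mathbf{y}_h)\in V_h\times V_h\times Q_{ad}^h$ solve the discrete optimality system (both written out in the context). Let $R\mathbf u,\bar R\boldsymbol\phi\in X$ and $R_0p\in M$ be the reconstructions defined in the context. Then there is a constant $C>0$, independent of the mesh-size, such that $$\|p-p_h\|_M\le C\big(\|R_0p-p_h\|_M+\|E_h\boldsymbol\phi_h-\Pi_h(E_h\boldsymbol\phi_h)\|_Q+\|R\mathbf u-\mathbf u_h\|_W+\|\boldsymbol\phi_h-\bar R\boldsymbol\phi\|_h\big).$$
   Context: All vector spaces are real. Continuous setting. $X,M,W,Q$ are Hilbert spaces, $V=X\times M$, with $X\subset W\subset X'$ with continuous inclusions ($X'$ the dual of $X$). $E:X\to Q$ is continuous and linear; $Q_{ad}\subset Q$ is nonempty, closed and convex. $\mathbf f,\mathbf u_d\in W$ and $\lambda>0$ are given. $a:X\times X\to\mathbb R$, $b:X\times M\to\mathbb R$ are continuous bilinear forms with $|a(\mathbf v,\mathbf z)|\le C_1\|\mathbf v\|_X\|\mathbf z\|_X$ and $|b(\mathbf z,p)|\le C_2\|\mathbf z\|_X\|p\|_M$; with $Z=\{\mathbf v\in X: b(\mathbf v,w)=0\ \forall w\in M\}$, $a$ is $Z$-elliptic: $\alpha\|\mathbf v\|_X^2\le a(\mathbf v,\mathbf v)$ for all $\mathbf v\in Z$, $\alpha>0$;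 and $b$ satisfies the inf-sup condition $\inf_{p\in M}\sup_{\mathbf z\in X} b(\mathbf z,p)/(\|\mathbf z\|_X\|p\|_M)\ge\beta>0$. Continuous optimality system for $((\mathbf u,p),(\boldsymbol\phi,r),\mathbf y)\in V\times V\times Q_{ad}$: for all $\mathbf z\in X$, $w\in M$, $\mathbf x\in Q_{ad}$, $a(\mathbf u,\mathbf z)+b(\mathbf z,p)=\langle\mathbf y,E\mathbf z\rangle_Q+\langle\mathbf f,\mathbf z\rangle_W$, $b(\mathbf u,w)=0$, $a(\mathbf z,\boldsymbol\phi)-b(\mathbf z,r)=\langle\mathbf u-\mathbf u_d,\mathbf z\rangle_W$, $b(\boldsymbol\phi,w)=0$, $\langle E\boldsymbol\phi+\lambda\mathbf y,\mathbf x-\mathbf y\rangle_Q\ge0$. Discrete setting. $X_h\subset W$ is a finite dimensional subspace, $\|\cdot\|_h$ is a norm on $X+X_h$ with $\|\mathbf v\|_h=\|\mathbf v\|_X$ for $\mathbf v\in X$; $M_h\subset M$ is a finite dimensional subspace with norm $\|\cdot\|_M$; $V_h=X_h\times M_h$; $Q_h\subseteq Q$ is a finite dimensional subspace and $Q_{ad}^h\subset Q_{ad}$ is a nonempty closed convex subset of $Q_h$. $a_h:X_h\times X_h\to\mathbb R$, $b_h:X_h\times M_h\to\mathbb R$ are bilinear with $|a_h(\mathbf v_h,\mathbf z_h)|\le\bar C_1\|\mathbf v_h\|_h\|\mathbf z_h\|_h$, $|b_h(\mathbf z_h,p_h)|\le\bar C_2\|\mathbf z_h\|_h\|p_h\|_M$;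 with $Z_h=\{\mathbf v_h\in X_h:b_h(\mathbf v_h,w_h)=0\ \forall w_h\in M_h\}$, $\bar\alpha\|\mathbf v_h\|_h^2\le a_h(\mathbf v_h,\mathbf v_h)$ on $Z_h$, $\bar\alpha>0$; and $\inf_{p_h\in M_h}\sup_{\mathbf z_h\in X_h}b_h(\mathbf z_h,p_h)/(\|\mathbf z_h\|_h\|p_h\|_M)\ge\bar C>0$. $E_h:X_h+X\to Q$ is linear with $E_h\mathbf v=E\mathbf v$ for $\mathbf v\in X$. Discrete optimality system for $((\mathbf u_h,p_h),(\boldsymbol\phi_h,r_h),\mathbf y_h)\in V_h\times V_h\times Q_{ad}^h$: for all $\mathbf z_h\in X_h$, $w_h\in M_h$, $\mathbf x_h\in Q_{ad}^h$, $a_h(\mathbf u_h,\mathbf z_h)+b_h(\mathbf z_h,p_h)=\langle\mathbf y_h,E_h\mathbf z_h\rangle_Q+\langle\mathbf f,\mathbf z_h\rangle_W$, $b_h(\mathbf u_h,w_h)=0$, $a_h(\mathbf z_h,\boldsymbol\phi_h)-b_h(\mathbf z_h,r_h)=\langle\mathbf u_h-\mathbf u_d,\mathbf z_h\rangle_W$, $b_h(\boldsymbol\phi_h,w_h)=0$, $\langle E_h\boldsymbol\phi_h+\lambda\mathbf y_h,\mathbf x_h-\mathbf y_h\rangle_Q\ge0$. Standing assumptions. (I) $\|\mathbf v\|_W\le C_W\|\mathbf v\|_h$ for all $\mathbf v\in X+X_h$. (II) $\|E_h(\mathbf v-\mathbf v_h)\|_Q\le\|\mathbf v-\mathbf v_h\|_h$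 for all $\mathbf v\in X,\mathbf v_h\in X_h$. (III) $\Pi_h:Q\to Q_h$ is the $Q$-orthogonal projection, and $\Pi_h\mathbf x\in Q_{ad}^h$ whenever $\mathbf x\in Q_{ad}$. Reconstructions. $(R\mathbf u,R_0p),(\bar R\boldsymbol\phi,\bar R_0r)\in X\times M$ are the unique solutions of: for all $\mathbf z\in X$, $w\in M$, $a(R\mathbf u,\mathbf z)+b(\mathbf z,R_0p)=\langle\mathbf y_h,E\mathbf z\rangle_Q+\langle\mathbf f,\mathbf z\rangle_W$, $b(R\mathbf u,w)=0$, $a(\mathbf z,\bar R\boldsymbol\phi)-b(\mathbf z,\bar R_0r)=\langle\mathbf u_h-\mathbf u_d,\mathbf z\rangle_W$, $b(\bar R\boldsymbol\phi,w)=0$. ''Independent of the mesh-size'' means: depending only on $\lambda$ and on the constants $C_1,C_2,\alpha,\beta,\bar C_1,\bar C_2,\bar\alpha,\bar C,C_W$. *)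

(* Defs.v *)
From HB Require Import structures.
From mathcomp Require Import all_boot all_order all_algebra sesquilinear.
From mathcomp Require Import all_classical all_reals all_analysis.

Set Implicit Arguments.
Unset Strict Implicit.
Unset Printing Implicit Defensive.

Import Order.TTheory GRing.Theory Num.Theory.
Import numFieldNormedType.Exports.

Local Open Scope classical_set_scope.
Local Open Scope ring_scope.

(* Real Hilbert spaces: the norm and the topology are those of the complete
   normed module, and the inner product induces that norm. *)
HB.mixin Record NormedModule_hasDot (R : realType) V of NormedModule R V := {
  dot : {dot V for @idfun R} ;
  normr_dot : forall v : V, `|v| ^+ 2 = dot v v
}.

#[short(type="hilbertType")]
HB.structure Definition Hilbert (R : realType) :=
  {V of CompleteNormedModule R V & NormedModule_hasDot R V}.

Notation "''[<' u , v '>]'" := (dot u v)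
  (at level 0, u at level 99, v at level 99,
   format "''[<' u ,  v '>]'") : ring_scope.

(* Functions and norms that live on a subspace [A] are represented by total
   functions; the predicates below constrain their values on [A] only. *)
Section subspaces.
Context {R : realType}.

Definition finite_dim_subspace (U : lmodType R) (A : set U) : Prop :=
  exists n (e : 'I_n -> U),
    A = [set \sum_(k < n) c k *: e k | c in [set: 'I_n -> R]].

Definition linear_on (U V : lmodType R) (A : set U) (g : U -> V) : Prop :=
  forall (c : R) u v, A u -> A v -> g (c *: u + v) = c *: g u + g v.

Definition bilinear_on (U V : lmodType R) (A : set U) (B : set V)
    (g : U -> V -> R) : Prop :=
  (forall v, B v -> linear_on A (fun u => g u v : R^o)) /\
  (forall u, A u -> linear_on B (fun v => g u v : R^o)).

Definition norm_on (U : lmodType R) (A : set U) (N : U -> R) : Prop :=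
  [/\ forall u v, A u -> A v -> N (u + v) <= N u + N v,
      forall (c : R) u, A u -> N (c *: u) = `|c| * N u
    & forall u, A u -> N u = 0 -> u = 0].

(* The sum [X + Xh] inside [W], where [i] is the inclusion of [X] in [W]. *)
Definition sum_space (X W : lmodType R) (i : X -> W) (Xh : set W) : set W :=
  [set i v + vh | v in [set: X] & vh in Xh].

End subspaces.

(* Below, [N] is the norm used on [A] in the first argument; the second argument
   always lives in a subspace [B] of a normed space [M]. *)
Section forms.
Context {R : realType}.

Definition constraint_kernel (U M : Type) (A : set U) (B : set M)
    (b : U -> M -> R) : set U :=
  [set v | A v /\ forall w, B w -> b v w = 0].

Definition elliptic_on (U : Type) (A : set U) (N : U -> R) (a : U -> U -> R)
    (alpha : R) : Prop :=
  forall v, A v -> alpha * N v ^+ 2 <= a v v.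

(* The infimum and supremum range over nonzero vectors and are taken in the
   extended reals. *)
Definition inf_sup_condition (U : lmodType R) (M : normedModType R)
    (A : set U) (B : set M) (N : U -> R) (b : U -> M -> R) (beta : R) : Prop :=
  (beta%:E <= ereal_inf
    [set ereal_sup [set (b z p / (N z * `|p|))%:E | z in A `\ 0%R]
    | p in B `\ 0%R])%E.

End forms.

(* [W] is identified with a subspace of the dual of [X] through
   [w |-> <w, i(.)>_W]; the last two clauses say that this map is injective and
   bounded for the operator norm. *)
Definition gelfand_inclusions (R : realType) (X W : hilbertType R)
    (i : {linear X -> W}) : Prop :=
  [/\ injective i,
      continuous i,
      injective (fun (w : W) (z : X) => '[<w, i z>])
    & exists K : R, forall (w : W) (z : X), `|'[<w, i z>]| <= K * `|w| * `|z|].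

(* [U] carries the velocity unknowns: [U = X], [J] the inclusion of [X] in [W]
   and [A = setT] for the continuous problem; [U = W], [J = id] and [A = X_h]
   for the discrete one. *)
Section systems.
Context {R : realType} {U M : Type} {W Q : hilbertType R}.
Variables (A : set U) (B : set M) (J : U -> W).
Variables (a : U -> U -> R) (b : U -> M -> R).

Definition state_system (E : U -> Q) (f : W) (y : Q) (u : U) (p : M) : Prop :=
  [/\ A u, B p,
      forall z, A z -> a u z + b z p = '[<y, E z>] + '[<f, J z>]
    & forall w, B w -> b u w = 0].

Definition adjoint_system (g : W) (phi : U) (r : M) : Prop :=
  [/\ A phi, B r,
      forall z, A z -> a z phi - b z r = '[<g, J z>]
    & forall w, B w -> b phi w = 0].

Definition optimality_system (K : set Q) (E : U -> Q) (f ud : W) (lambda : R)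
    (u : U) (p : M) (phi : U) (r : M) (y : Q) : Prop :=
  [/\ K y,
      state_system E f y u p,
      adjoint_system (J u - ud) phi r
    & forall x, K x -> 0 <= '[<E phi + lambda *: y, x - y>]].

End systems.

Definition orthogonal_projection (R : realType) (Q : hilbertType R)
    (A : set Q) (P : Q -> Q) : Prop :=
  forall x, A (P x) /\ forall q, A q -> '[<x - P x, q>] = 0.

(* Main.v *)
(** The state equation is stable: by ellipticity on the kernel of [b] and the
    inf-sup condition, both [u - Ru] and [p - R0p] are controlled by [y - yh].
    Testing the continuous variational inequality with [yh] and the discrete one
    with [Pih y], and moving [E (phi - Rphi)] onto the state through the two
    saddle point systems, turns [y - yh] into the remaining three terms; the
    quadratic term [- |i (u - Ru)|^2] produced on the way has the good sign. *)
Require Import Defs.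
From mathcomp Require Import all_boot all_order all_algebra sesquilinear.
From mathcomp Require Import all_classical all_reals all_analysis.
From mathcomp Require Import ring lra.
Import Order.TTheory GRing.Theory Num.Theory.
Import numFieldNormedType.Exports.
Local Open Scope classical_set_scope.
Local Open Scope ring_scope.

(** * Cauchy-Schwarz inequality *)

Section inner_product.
Context {R : realType} {V : hilbertType R}.
Implicit Types u v : V.

Lemma dotC u v : '[<u, v>] = '[<v, u>].
Proof. by rewrite hermC expr0 mul1r. Qed.

Lemma normrB_sqr u v :
  `|u - v| ^+ 2 = `|u| ^+ 2 - 2 * '[<u, v>] + `|v| ^+ 2.
Proof.
rewrite !normr_dot linearBl !linearBr /= (dotC v u); ring.
Qed.

Lemma dot_le_normM u v : '[<u, v>] <= `|u| * `|v|.
Proof.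
have [->|u0] := eqVneq u 0; first by rewrite linear0l normr0 mul0r.
have [->|v0] := eqVneq v 0; first by rewrite linear0r normr0 mulr0.
have uv_gt0 : 0 < `|u| * `|v| by rewrite mulr_gt0 ?normr_gt0.
(* The square expands to [2 * |u| * |v| * (|u| * |v| - '[<u, v>])]. *)
have := exprn_ge0 2 (normr_ge0 (`|v| *: u - `|u| *: v)).
rewrite normrB_sqr !normrZ !normr_id (linearZl_LR (@dot R V)) (linearZr_LR (@dot R V)) /= => h.
rewrite -(ler_pM2l uv_gt0); lra.
Qed.

Lemma normr_dot_le u v : `|'[<u, v>]| <= `|u| * `|v|.
Proof.
rewrite ler_norml dot_le_normM andbT lerNl.
by rewrite -linearNl (le_trans (dot_le_normM _ _)) // normrN.
Qed.

End inner_product.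

(** Every quotient in the supremum at [p] is at most [K / |p|], and the infimum is at most that
    supremum. The sign of [K] settles [p = 0], which the infimum leaves out. *)
Lemma inf_sup_le {R : realType} {U : lmodType R} {M : normedModType R}
    (A : set U) (B : set M) (N : U -> R) (b : U -> M -> R) (beta K : R) (p : M) :
  inf_sup_condition A B N b beta ->
  (forall z, A z -> z != 0 -> 0 < N z) -> 0 <= K -> B p ->
  (forall z, A z -> b z p <= K * N z) ->
  beta * `|p| <= K.
Proof.
move=> infsup N_gt0 K0 Bp le_b.
have [->|p0] := eqVneq p 0; first by rewrite normr0 mulr0.
have p_gt0 : 0 < `|p| by rewrite normr_gt0.
rewrite -ler_pdivlMr // -lee_fin; apply: le_trans infsup _.
apply: le_trans (ereal_inf_lbound _) _.
  by exists p => //; split=> //=; exact/eqP.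
apply: ge_ereal_sup => _ [z [Az /= /eqP z0] <-].
have Nz := N_gt0 z Az z0.
rewrite lee_fin ler_pdivrMr ?mulr_gt0//.
suff -> : K / `|p| * (N z * `|p|) = K * N z by exact: le_b.
by field; rewrite gt_eqF.
Qed.

(** * Stability and duality for the continuous saddle point systems *)

Section error_estimates.
Context {R : realType} {X M W Q : hilbertType R} {i : {linear X -> W}}
  {E : {linear X -> Q}}
  {a : {bilinear X -> X -> R | *%R & *%R}}
  {b : {bilinear X -> M -> R | *%R & *%R}} {C1 alpha beta : R}.
Hypothesis alpha_gt0 : 0 < alpha.
Hypothesis beta_gt0 : 0 < beta.
Hypothesis a_bounded : forall v z, `|a v z| <= C1 * `|v| * `|z|.
Hypothesis a_elliptic :
  elliptic_on (constraint_kernel [set: X] [set: M] b) (fun v => `|v|) a alpha.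
Hypothesis b_infsup :
  inf_sup_condition [set: X] [set: M] (fun v => `|v|) b beta.
Hypothesis E_contraction : forall z, `|E z| <= `|z|.

Section state_stability.
Context {f : W} {y y' : Q} {u u' : X} {p p' : M}.
Hypothesis state_y : state_system [set: X] [set: M] i a b E f y u p.
Hypothesis state_y' : state_system [set: X] [set: M] i a b E f y' u' p'.

Lemma state_diff z : a (u - u') z + b z (p - p') = '[<y - y', E z>].
Proof.
case: state_y state_y' => _ _ + _ [_ _ + _] => /(_ z I) h /(_ z I) h'.
rewrite !linearBl linearBr /=; lra.
Qed.

Lemma state_diff_kernel w : b (u - u') w = 0.
Proof.
case: state_y state_y' => _ _ _ h [_ _ _ h'].
by rewrite linearBl /= h// h'// subrr.
Qed.

(** Testing with [u - u'], which lies in the kernel of [b], removes the pressure; ellipticity and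
    [E_contraction] then leave one factor [|u - u'|] to cancel. *)
Lemma state_velocity_le : `|u - u'| <= alpha^-1 * `|y - y'|.
Proof.
have [->|uu'] := eqVneq (u - u') 0.
  by rewrite normr0 mulr_ge0 // invr_ge0 ltW.
have uu'_gt0 : 0 < `|u - u'| by rewrite normr_gt0.
have ell : alpha * `|u - u'| ^+ 2 <= a (u - u') (u - u').
  by apply: a_elliptic; split=> // w _; exact: state_diff_kernel.
have := state_diff (u - u'); rewrite state_diff_kernel addr0 => auu'.
rewrite ler_pdivlMl // -(ler_pM2r uu'_gt0) -mulrA -expr2.
rewrite (le_trans ell)// auu' (le_trans (dot_le_normM _ _))//.
by rewrite ler_wpM2l.
Qed.

(** The state equation expresses [b z (p - p')] by the load and [a (u - u') z], which the velocity
    bound controls; the inf-sup condition then recovers the pressure. No sign of [C1] is assumed,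
    hence [|C1|]. *)
Lemma state_pressure_le :
  `|p - p'| <= beta^-1 * (1 + `|C1| / alpha) * `|y - y'|.
Proof.
rewrite -mulrA ler_pdivlMl //.
apply: inf_sup_le b_infsup _ _ _ _ => //.
- by move=> z _; rewrite normr_gt0.
- by rewrite mulr_ge0 // addr_ge0 // mulr_ge0 // invr_ge0 ltW.
move=> z _.
have -> : b z (p - p') = '[<y - y', E z>] - a (u - u') z.
  by rewrite -state_diff addrAC subrr add0r.
rewrite !mulrDl mul1r lerD //.
  by rewrite (le_trans (dot_le_normM _ _))// ler_wpM2l.
rewrite (le_trans (ler_norm _))// normrN (le_trans (a_bounded _ _))//.
rewrite ler_wpM2r // -mulrA (le_trans (ler_wpM2r _ (ler_norm _)))//.
by rewrite ler_wpM2l // state_velocity_le.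
Qed.

(** Test the state difference with [phi - phi'] and the adjoint difference with [u - u']: both [b]
    terms vanish, so the left side is [- '[<i u - uh, i (u - u')>]]. Splitting [i u - uh] at [i u']
    isolates a negative square, which is dropped. *)
Lemma adjoint_coupling_le {g : W} {phi phi' : X} {r r' : M} {uh : W} :
  adjoint_system [set: X] [set: M] i a b (i u - g) phi r ->
  adjoint_system [set: X] [set: M] i a b (uh - g) phi' r' ->
  '[<E phi - E phi', y' - y>] <= `|i u' - uh| * `|i (u - u')|.
Proof.
move=> [_ _ adj adj0] [_ _ adj' adj0'].
have adj_diff : a (u - u') (phi - phi') = '[<i u - uh, i (u - u')>].
  move: (adj (u - u') I) (adj' (u - u') I).
  rewrite !state_diff_kernel (linearBr a) /= !linearBl /= => h h'; lra.
have b_diff : b (phi - phi') (p - p') = 0.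
  by rewrite linearBl /= adj0// adj0'// subrr.
have -> : '[<E phi - E phi', y' - y>] = - '[<i u - uh, i (u - u')>].
  rewrite -adj_diff -[a _ _]addr0 -b_diff state_diff.
  by rewrite -(linearB E) -(linearNl dot) opprB dotC.
have -> : i u - uh = i (u - u') + (i u' - uh).
  by rewrite (linearB i) addrA subrK.
rewrite (linearDl dot) /= -normr_dot opprD.
have := sqr_ge0 `|i (u - u')|.
have := normr_dot_le (i u' - uh) (i (u - u')).
rewrite ler_norml => /andP[h _] h'; lra.
Qed.

End state_stability.
End error_estimates.

(** Add [vi] at [yh] and [vih] at [P y]. Replacing [P y] by [y] costs ['[<eh, P y - y>]], which
    equals ['[<eh - P eh, yh - y>]] since [y - P y] and [eh - P eh] are orthogonal to [Qh]. *)
Lemma control_error_le {R : realType} {Q : hilbertType R} {K Kh Qh : set Q}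
    {P : Q -> Q} {lambda : R} {e eh y yh : Q} :
  Kh `<=` K -> Kh `<=` Qh ->
  orthogonal_projection Qh P -> (forall x, K x -> Kh (P x)) ->
  K y -> Kh yh ->
  (forall x, K x -> 0 <= '[<e + lambda *: y, x - y>]) ->
  (forall x, Kh x -> 0 <= '[<eh + lambda *: yh, x - yh>]) ->
  lambda * `|y - yh| ^+ 2
    <= '[<e - eh, yh - y>] + `|eh - P eh| * `|y - yh|.
Proof.
move=> KhK KhQh projP PK Ky Khyh vi vih.
have [[_ Peh] [QPy Py]] := (projP eh, projP y).
have Qyh := KhQh _ Khyh.
have := vih _ (PK _ Ky); have := vi _ (KhK _ Khyh).
have := Peh _ Qyh; have := Peh _ QPy.
have := Py _ Qyh; have := Py _ (projP eh).1.
have := dot_le_normM (P eh - eh) (y - yh); rewrite (distrC (P eh)).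
rewrite normr_dot !(linearBl, linearBr, linearDl) /=.
have Zl c (s t : Q) : '[<c *: s, t>] = c * '[<s, t>] := linearZl_LR dot t c s.
rewrite !Zl (dotC yh y) (dotC y (P eh)) (dotC (P y) (P eh)) (dotC y).
rewrite (dotC (P y) yh).
move=> h1 h2 h3 h4 h5 h6.
(* In [vih] this product carries the factor [lambda], so it is replaced before the linear
   arithmetic. *)
have -> : '[<yh, P y>] = '[<yh, y>] by lra.
by move=> h7; lra.
Qed.

Theorem theorem2p9 (R : realType)
  (lambda C1 C2 alpha beta C1h C2h alphah betah CW : R)
  (lambda_gt0 : 0 < lambda) (alpha_gt0 : 0 < alpha) (beta_gt0 : 0 < beta)
  (alphah_gt0 : 0 < alphah) (betah_gt0 : 0 < betah) :
  exists C : R, 0 < C /\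
  forall (* continuous setting *)
    (X M W Q : hilbertType R)
    (i : {linear X -> W}) (_ : gelfand_inclusions i)
    (E : {linear X -> Q}) (_ : continuous E)
    (Qad : set Q) (_ : Qad !=set0) (_ : closed Qad) (_ : convex_set Qad)
    (f ud : W)
    (a : {bilinear X -> X -> R | *%R & *%R})
    (b : {bilinear X -> M -> R | *%R & *%R})
    (_ : forall v z, `|a v z| <= C1 * `|v| * `|z|)
    (_ : forall z p, `|b z p| <= C2 * `|z| * `|p|)
    (_ : elliptic_on (constraint_kernel [set: X] [set: M] b)
           (fun v => `|v|) a alpha)
    (_ : inf_sup_condition [set: X] [set: M] (fun v => `|v|) b beta)
    (* discrete setting *)
    (Xh : set W) (_ : finite_dim_subspace Xh)
    (normh : W -> R) (_ : norm_on (sum_space i Xh) normh)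
    (_ : forall v : X, normh (i v) = `|v|)
    (Mh : set M) (_ : finite_dim_subspace Mh)
    (Qh : set Q) (_ : finite_dim_subspace Qh)
    (Qadh : set Q) (_ : Qadh `<=` Qad) (_ : Qadh `<=` Qh)
    (_ : Qadh !=set0) (_ : closed Qadh) (_ : convex_set Qadh)
    (ah : W -> W -> R) (_ : bilinear_on Xh Xh ah)
    (bh : W -> M -> R) (_ : bilinear_on Xh Mh bh)
    (_ : forall vh zh, Xh vh -> Xh zh ->
           `|ah vh zh| <= C1h * normh vh * normh zh)
    (_ : forall zh ph, Xh zh -> Mh ph ->
           `|bh zh ph| <= C2h * normh zh * `|ph|)
    (_ : elliptic_on (constraint_kernel Xh Mh bh) normh ah alphah)
    (_ : inf_sup_condition Xh Mh normh bh betah)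
    (Eh : W -> Q) (_ : linear_on (sum_space i Xh) Eh)
    (_ : forall v : X, Eh (i v) = E v)
    (* standing assumptions (I), (II), (III) *)
    (_ : forall v, sum_space i Xh v -> `|v| <= CW * normh v)
    (_ : forall (v : X) vh, Xh vh -> `|Eh (i v - vh)| <= normh (i v - vh))
    (Pih : Q -> Q) (_ : orthogonal_projection Qh Pih)
    (_ : forall x, Qad x -> Qadh (Pih x))
    (* continuous and discrete solutions *)
    (u : X) (p : M) (phi : X) (r : M) (y : Q)
    (_ : optimality_system [set: X] [set: M] i a b Qad E f ud lambda
           u p phi r y)
    (uh : W) (ph : M) (phih : W) (rh : M) (yh : Q)
    (_ : optimality_system Xh Mh id ah bh Qadh Eh f ud lambda
           uh ph phih rh yh)
    (* reconstructions *)
    (Ru : X) (R0p : M) (Rphi : X) (R0r : M)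
    (_ : state_system [set: X] [set: M] i a b E f yh Ru R0p)
    (_ : adjoint_system [set: X] [set: M] i a b (uh - ud) Rphi R0r),
  `|p - ph| <= C * (`|R0p - ph| + `|Eh phih - Pih (Eh phih)|
                    + `|i Ru - uh| + normh (phih - i Rphi)).

Proof.
(* [cp] is the pressure stability constant; [cy] comes from dividing the control estimate by
   [lambda * |y - yh|]. *)
pose cp := beta^-1 * (1 + `|C1| / alpha).
pose cy := lambda^-1 * (1 + `|CW| / alpha).
have cp_ge0 : 0 <= cp.
  by rewrite mulr_ge0 ?addr_ge0 ?divr_ge0 ?invr_ge0 // ltW.
have cy_ge0 : 0 <= cy.
  by rewrite mulr_ge0 ?addr_ge0 ?divr_ge0 ?invr_ge0 // ltW.
exists (1 + cp * cy); split; first by rewrite ltr_pwDl // mulr_ge0.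
move=> X M W Q i _ E _ Qad _ _ _ f ud a b a_bounded _ a_ell b_infsup.
move=> Xh [nX [eX XhE]] normh [_ normhZ _] normhX Mh _ Qh _.
move=> Qadh QadhK QadhQ _ _ _ ah _ bh _ _ _ _ _ Eh Eh_lin EhX normW Eh_le Pih projP PQad.
move=> u p phi r y [Qy st adj vi].
move=> uh ph phih rh yh [Qyh _ [Xphih _ _ _] vih].
move=> Ru R0p Rphi R0r stR adjR.
have Xh0 : Xh 0.
  by rewrite XhE; exists (fun=> 0) => //; rewrite big1 // => k _; rewrite scale0r.
(* Assumption (II) with zero discrete part. *)
have E_contraction z : `|E z| <= `|z|.
  by rewrite -EhX -normhX -[i z]subr0 Eh_le.
have sum_i v : sum_space i Xh (i v) by exists v => //; exists 0; rewrite ?addr0.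
have sum_h vh : Xh vh -> sum_space i Xh vh.
  by move=> Xvh; exists 0 => //; exists vh; rewrite // linear0 add0r.
have Eerr : `|E Rphi - Eh phih| <= normh (phih - i Rphi).
  have -> : E Rphi - Eh phih = Eh (i Rphi - phih).
    rewrite -EhX addrC -scaleN1r -Eh_lin; [|exact: sum_h|exact: sum_i].
    by rewrite scaleN1r addrC.
  apply: le_trans (Eh_le _ _ Xphih) _.
  have -> : i Rphi - phih = (-1) *: (phih - i Rphi) by rewrite scaleN1r opprB.
  rewrite normhZ ?normrN1 ?mul1r //.
  by exists (- Rphi) => //; exists phih; rewrite // linearN addrC.
have vel := state_velocity_le alpha_gt0 a_ell E_contraction st stR.
have prs := state_pressure_le alpha_gt0 beta_gt0 a_bounded a_ell b_infsup
  E_contraction st stR.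
have cpl := adjoint_coupling_le st stR adj adjR.
have ctl := control_error_le QadhK QadhQ projP PQad Qy Qyh vi vih.
(* Assumption (I), then velocity stability. *)
have iverr : `|i (u - Ru)| <= `|CW| / alpha * `|y - yh|.
  apply: le_trans (normW _ (sum_i _)) _; rewrite normhX -mulrA.
  by rewrite (le_trans (ler_wpM2r _ (ler_norm _)))// ler_wpM2l.
have yerr : `|y - yh| <= cy * (`|Eh phih - Pih (Eh phih)|
     + `|i Ru - uh| + normh (phih - i Rphi)).
  have [->|yyh] := eqVneq (y - yh) 0.
    rewrite normr0 mulr_ge0 // !addr_ge0 //.
    exact: le_trans Eerr.
  have y_gt0 : 0 < `|y - yh| by rewrite normr_gt0.
  rewrite -mulrA ler_pdivlMl // -(ler_pM2r y_gt0) -mulrA -expr2.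
  apply: le_trans ctl _.
  (* Inserting [E Rphi] separates the duality term from the adjoint reconstruction error. *)
  have -> : E phi - Eh phih = (E phi - E Rphi) + (E Rphi - Eh phih).
    by rewrite addrA subrK.
  rewrite (linearDl dot) /=.
  have k_ge0 : 0 <= `|CW| / alpha by rewrite divr_ge0 // ltW.
  set k := `|CW| / alpha in k_ge0 iverr *.
  have cplk : '[<E phi - E Rphi, yh - y>] <= `|i Ru - uh| * (k * `|y - yh|).
    by apply: le_trans cpl _; rewrite ler_wpM2l.
  have rec : '[<E Rphi - Eh phih, yh - y>]
      <= normh (phih - i Rphi) * `|y - yh|.
    by apply: le_trans (dot_le_normM _ _) _; rewrite (distrC yh) ler_wpM2r.
  have h_ge0 := le_trans (normr_ge0 _) Eerr.
  have e_ge0 := normr_ge0 (i Ru - uh).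
  have n_ge0 := normr_ge0 (Eh phih - Pih (Eh phih)).
  (* The true weights are [k] on [|i Ru - uh|] and 1 on the other two terms; these products are the
     slack up to the common weight [1 + k]. *)
  have := mulr_ge0 (mulr_ge0 k_ge0 (addr_ge0 h_ge0 n_ge0)) (ltW y_gt0).
  have := mulr_ge0 e_ge0 (ltW y_gt0).
  move=> ? ?; lra.
have -> : p - ph = (p - R0p) + (R0p - ph) by rewrite addrA subrK.
apply: le_trans (ler_normD _ _) _.
have h_ge0 := le_trans (normr_ge0 _) Eerr.
have perr := le_trans prs (ler_wpM2l cp_ge0 yerr).
(* Slack again: [|R0p - ph|] has true weight 1 and the other terms [cp * cy]. *)
have := mulr_ge0 (mulr_ge0 cp_ge0 cy_ge0) (normr_ge0 (R0p - ph)).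
have := normr_ge0 (i Ru - uh).
have := normr_ge0 (Eh phih - Pih (Eh phih)).
move=> ? ? ?; lra.
Qed.
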